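(* Let $n\geqslant 3$ and let $\alpha=(\alpha_1,\ldots,\alpha_n)\in\mathbb{R}^n$ be a vector whose coordinates are algebraically independent over $\mathbb{Q}$. Then $\operatorname{rank}_+ D(\alpha)\geqslant 2\sqrt{n}-2$.
   Context: For $\alpha\in\mathbb{R}^n$, the Euclidean distance matrix $D(\alpha)$ is the $n\times n$ matrix with entries $D_{ij}=(\alpha_i-\alpha_j)^2$. For a real matrix $A$ with nonnegative entries, the nonnegative rank $\operatorname{rank}_+(A)$ is the smallest integer $k$ such that $A$ can be written as a sum of $k$ nonnegative matrices of rank one. *)

(* Defs.v *)
From HB Require Import structures.
From mathcomp Require Import all_boot all_order all_algebra.
Set Implicit Arguments. Unset Strict Implicit. Unset Printing Implicit Defensive.
Import Order.TTheory GRing.Theory Num.Theory.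
Local Open Scope ring_scope.

Definition edm (R : pzRingType) (n : nat) (alpha : 'I_n -> R) : 'M[R]_n :=
  \matrix_(i < n, j < n) (alpha i - alpha j) ^+ 2.

Definition nonneg_mx (R : numDomainType) (m n : nat) (A : 'M[R]_(m, n)) : Prop :=
  forall i j, 0 <= A i j.

Definition nonneg_rank1_sum (R : realFieldType) (m n k : nat)
    (A : 'M[R]_(m, n)) : Prop :=
  exists B : 'I_k -> 'M[R]_(m, n),
    (forall l, nonneg_mx (B l) /\ \rank (B l) = 1%N) /\ A = \sum_(l < k) B l.

(* The coordinates of alpha are algebraically independent over Q:
   every polynomial with rational coefficients (given by its coefficients
   on the monomials prod_i X_i^(e i) with all exponents < d) vanishing at
   alpha is the zero polynomial. *)
Definition alg_indep_Q (R : realFieldType) (n : nat) (alpha : 'I_n -> R) : Prop :=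
  forall (d : nat) (c : {ffun {ffun 'I_n -> 'I_d} -> rat}),
    \sum_(e : {ffun 'I_n -> 'I_d}) ratr (c e) * \prod_(i < n) alpha i ^+ e i = 0 ->
    forall e, c e = 0.

(* Main.v *)
(* Write D = U V^T with U, V having k columns; since the diagonal of D vanishes, row i of U
   and row i of V have disjoint supports.  Since D has rank 3, there is a linear map from the
   row space W of V to R^3 sending row j of V to the point (1, alpha_j, alpha_j^2), and row i
   of U then acts on W as the tangent line to the parabola at the i-th point.  The subspace
   W_i of W defined by the vanishing of the coordinates in the support of row i of U contains
   row i of V and is mapped into that tangent line, so alpha_i is a rational function of the
   parameters describing W and the map to R^3.  If r = dim W, these can be normalised to
   r (k - r) + 2 r parameters, hence n <= r (k + 2 - r) <= (k + 2)^2 / 4. *)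
Require Import Defs.
From HB Require Import structures.
From mathcomp Require Import all_boot all_order all_algebra.
From mathcomp Require Import mpoly boolp.
From mathcomp Require Import ring zify.
Set Implicit Arguments. Unset Strict Implicit. Unset Printing Implicit Defensive.
Import Order.TTheory GRing.Theory Num.Theory.
Local Open Scope ring_scope.

(** * The subfield of [R] generated over the rationals by finitely many elements *)

Section AdjoinQ.
Variables (R : realFieldType) (m : nat) (y : 'I_m -> R).

Definition evalQ : {mpoly rat[m]} -> R := mmap ratr y.
HB.instance Definition _ := GRing.RMorphism.on evalQ.

Definition adjoinQ : {pred R} :=
  [pred x | `[< exists p q, evalQ q != 0 /\ x = evalQ p / evalQ q >]].

Lemma adjoinQP x :
  reflect (exists p q, evalQ q != 0 /\ x = evalQ p / evalQ q) (x \in adjoinQ).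
Proof. exact: asboolP. Qed.

Lemma evalQ_adjoinQ p : evalQ p \in adjoinQ.
Proof. by apply/adjoinQP; exists p, 1; rewrite rmorph1 oner_neq0 divr1. Qed.

Lemma gen_adjoinQ i : y i \in adjoinQ.
Proof.
suff -> : y i = evalQ 'X_i by apply: evalQ_adjoinQ.
by rewrite /evalQ mmapX mmap1U.
Qed.

Fact adjoinQ_divring_closed : divring_closed adjoinQ.
Proof.
split.
- by rewrite -(rmorph1 evalQ) evalQ_adjoinQ.
- move=> _ _ /adjoinQP[p [q [q0 ->]]] /adjoinQP[p' [q' [q0' ->]]].
  apply/adjoinQP; exists (p * q' - p' * q), (q * q').
  by rewrite rmorphB !rmorphM mulf_neq0 // -[- (_ / _)]mulNr addf_div // mulNr.
- move=> _ _ /adjoinQP[p [q [q0 ->]]] /adjoinQP[p' [q' [q0' ->]]].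
  (* The inverse of 0 is 0, so a zero divisor gives the quotient 0. *)
  have [p0'|p0'] := eqVneq (evalQ p') 0.
    rewrite p0' mul0r invr0 mulr0 -(rmorph0 evalQ); exact: evalQ_adjoinQ.
  apply/adjoinQP; exists (p * q'), (q * p').
  by rewrite !rmorphM mulf_neq0 // invf_div mulf_div.
Qed.
HB.instance Definition _ :=
  GRing.isDivringClosed.Build R adjoinQ adjoinQ_divring_closed.

Definition Qadj := {x : R | x \in adjoinQ}.
HB.instance Definition _ := SubType.on Qadj.
HB.instance Definition _ := Choice.on Qadj.
HB.instance Definition _ := [SubChoice_isSubIntegralDomain of Qadj by <:].
HB.instance Definition _ := [SubIntegralDomain_isSubField of Qadj by <:].

End AdjoinQ.

(** * Rational linear relations and descent to a subfield *)

(** The coefficient matrix has more rows than columns, so its left kernel, taken over [rat], is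
    nonzero. *)
Lemma dependent_of_card (R : numFieldType) (I J : finType) (x : I -> R)
    (b : J -> R) (a : I -> J -> rat) :
    (#|J| < #|I|)%N -> (forall i, x i = \sum_j ratr (a i j) * b j) ->
  exists2 c : {ffun I -> rat}, exists i, c i != 0 & \sum_i ratr (c i) * x i = 0.
Proof.
move=> ltJI xE.
pose A := \matrix_(i < #|I|, j < #|J|) a (enum_val i) (enum_val j).
have /rowV0Pn[v /sub_kermxP vA /rV0Pn[i vi]] : kermx A != 0.
  by rewrite kermx_eq0 /row_free ltn_eqF // (leq_ltn_trans (rank_leq_col A)).
exists [ffun i => v 0 (enum_rank i)].
  by exists (enum_val i); rewrite ffunE enum_valK.
under eq_bigr => k _ do rewrite ffunE xE mulr_sumr.
rewrite exchange_big big1 //= => j _.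
under eq_bigr => k _ do rewrite mulrA.
rewrite -mulr_suml; suff -> : \sum_k ratr (v 0 (enum_rank k)) * ratr (a k j) = 0 :> R.
  by rewrite mul0r.
move/matrixP/(_ 0 (enum_rank j)): vA; rewrite !mxE => vA.
transitivity (ratr 0 : R); last exact: rmorph0.
rewrite -vA rmorph_sum (reindex_onto enum_rank enum_val) /=; last first.
  by move=> k _; rewrite enum_valK.
apply: eq_big => [k|k _]; first by rewrite enum_rankK eqxx.
by rewrite mxE !enum_rankK rmorphM.
Qed.

(* The vectors supported outside [S] form a subspace defined over [K].  Its image under [L]
   lies in the plane orthogonal to [(alpha ^ 2, - 2 alpha, 1)] and contains
   [(1, alpha, alpha ^ 2)]: either it is the whole plane, and determines the normal, or it
   is the line through this point; in both cases [alpha] is rational over [K]. *)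
Lemma parabola_descent (K : fieldType) (R : numFieldType) (f : {rmorphism K -> R})
    (r k : nat) (A : 'M[K]_(r, k)) (L : 'M[K]_(r, 3)) (S : pred 'I_k) (alpha : R) :
  (forall x : 'rV[R]_r, (forall s, S s -> (x *m map_mx f A) 0 s = 0) ->
     let w := x *m map_mx f L in
     alpha ^+ 2 * w 0 0 - 2 * alpha * w 0 1 + w 0 2%:R = 0) ->
  (exists x : 'rV[R]_r, (forall s, S s -> (x *m map_mx f A) 0 s = 0) /\
     (x *m map_mx f L) 0 0 = 1 /\ (x *m map_mx f L) 0 1 = alpha) ->
  exists a : K, alpha = f a.
Proof.
move=> orth [x [xS [x0 x1]]].
(* Zeroing the columns outside [S] turns the support condition into a kernel, which commutes with
   extension of scalars. *)
pose AS := \matrix_(i, s) (A i s *+ S s).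
have kerS (z : 'rV[R]_r) : z *m map_mx f AS = 0 <->
    forall s, S s -> (z *m map_mx f A) 0 s = 0.
  have zE s : (z *m map_mx f AS) 0 s = (z *m map_mx f A) 0 s *+ S s.
    by rewrite !mxE -sumrMnl; apply: eq_bigr => i _; rewrite !mxE rmorphMn mulrnAr.
  split=> [z0 s Ss|zS].
    by move/matrixP/(_ 0 s): z0; rewrite zE Ss mulr1n => ->; rewrite mxE.
  by apply/rowP => s; rewrite zE [RHS]mxE; case: (boolP (S s)) => [/zS->|_]; rewrite ?mul0rn ?mulr0n.
pose Z := kermx AS *m L.
have orthZ i : alpha ^+ 2 * f (Z i 0) - 2 * alpha * f (Z i 1) + f (Z i 2%:R) = 0.
  have /orth /= : forall s, S s -> (row i (kermx (map_mx f AS)) *m map_mx f A) 0 s = 0.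
    by apply/kerS; rewrite -row_mul mulmx_ker row0.
  by rewrite -row_mul -map_kermx -map_mxM !mxE.
have {}/kerS/sub_kermxP/submxP[c xE] := xS.
have xLE j : (x *m map_mx f L) 0 j = \sum_i c 0 i * f (Z i j).
  rewrite xE -mulmxA -map_kermx -map_mxM mxE.
  by apply: eq_bigr => i _; rewrite !mxE.
rewrite !xLE in x0 x1.
have [/existsP[i /existsP[j]]|] :=
  boolP [exists i, exists j, Z i 0 * Z j 1 != Z i 1 * Z j 0].
  rewrite -subr_eq0 => d0.
  (* Eliminate [alpha ^+ 2] between the equations [orthZ i] and [orthZ j]. *)
  exists ((Z i 0 * Z j 2%:R - Z i 2%:R * Z j 0) / (2%:R * (Z i 0 * Z j 1 - Z i 1 * Z j 0))).
  have : f (Z i 0 * Z j 1 - Z i 1 * Z j 0) != 0 by rewrite fmorph_eq0.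
  rewrite fmorph_div !(rmorphB, rmorphM, rmorph_nat) => fd0.
  have := orthZ i; have := orthZ j; move: fd0.
  move: (f (Z i 0)) (f (Z i 1)) (f (Z i 2%:R)) (f (Z j 0)) (f (Z j 1)) (f (Z j 2%:R)).
  move=> a b e a' b' e' fd0 o' o.
  have two0 : 2%:R != 0 :> R by rewrite pnatr_eq0.
  apply: (mulIf (mulf_neq0 two0 fd0)).
  rewrite divfK ?mulf_neq0 //.
  have -> : e = 2 * alpha * b - alpha ^+ 2 * a.
    by apply/eqP; rewrite -subr_eq0 -o; apply/eqP; ring.
  have -> : e' = 2 * alpha * b' - alpha ^+ 2 * a'.
    by apply/eqP; rewrite -subr_eq0 -o'; apply/eqP; ring.
  ring.
(* Now all pairs [(Z i 0, Z i 1)] are proportional, and [(1, alpha)] is a combination of them. *)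
rewrite negb_exists => /forallP minors.
have [i Zi0] : exists i, Z i 0 != 0.
  apply/existsP; apply: contraT; rewrite negb_exists => /forallP Z0.
  move: x0; rewrite big1 => [/eqP|i _]; first by rewrite eq_sym oner_eq0.
  by have := Z0 i; rewrite negbK => /eqP ->; rewrite rmorph0 mulr0.
exists (Z i 1 / Z i 0); rewrite -x1 -[RHS]mulr1 -x0 mulr_sumr.
apply: eq_bigr => j _; rewrite mulrCA -rmorphM; congr (_ * f _).
have := minors i; rewrite negb_exists => /forallP /(_ j); rewrite negbK => /eqP Zij.
by apply: (mulfI Zi0); rewrite Zij mulrA mulrCA divff // mulr1.
Qed.

(** * Echelon bases and the parabola factorization of the distance matrix *)

Lemma sum_ord3 (V : nmodType) (F : 'I_3 -> V) :
  \sum_t F t = F 0 + F 1 + F 2%:R.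
Proof.
rewrite !big_ord_recl big_ord0 addr0 addrA.
by congr (_ + F _ + F _); apply: val_inj.
Qed.

Lemma alg_indep_inj (R : realFieldType) n (alpha : 'I_n -> R) :
  alg_indep_Q alpha -> injective alpha.
Proof.
move=> indep i j aij; apply/eqP; apply: contraT => neqij.
pose e (l : 'I_n) : {ffun 'I_n -> 'I_2} := [ffun k => inord (k == l)].
have eE l k : e l k = (k == l) :> nat by rewrite ffunE inordK // ltnS leq_b1.
have emon l : \prod_(k < n) alpha k ^+ e l k = alpha l.
  rewrite (bigD1 l) //= eE eqxx big1 ?mulr1 // => k /negPf kl.
  by rewrite eE kl.
have neqe : e j != e i.
  apply: contra_neq neqij => /ffunP/(_ i)/(congr1 val) /=.
  by rewrite !eE eqxx; case: (i =P j).
pose c : {ffun {ffun 'I_n -> 'I_2} -> rat} :=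
  [ffun k => (k == e i)%:R - (k == e j)%:R].
suff /indep/(_ (e i)) : \sum_k ratr (c k) * \prod_(l < n) alpha l ^+ k l = 0.
  by rewrite ffunE eqxx [e i == e j]eq_sym (negPf neqe) subr0 => /eqP; rewrite oner_eq0.
rewrite (bigD1 (e i)) // (bigD1 (e j)) //= [X in _ + (_ + X)]big1 => [|k /andP[/negPf ki /negPf kj]].
  rewrite !ffunE !eqxx (negPf neqe) [e i == e j]eq_sym (negPf neqe) !emon aij.
  by rewrite subr0 sub0r rmorph1 rmorphN1 mul1r mulN1r addr0 subrr.
by rewrite ffunE ki kj subrr rmorph0 mul0r.
Qed.

(** Some maximal minor of a row basis is invertible; multiplying by its inverse makes those columns
    the identity. *)
Lemma pivot_basis (F : fieldType) (n k : nat) (A : 'M[F]_(n, k)) :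
  exists (B : 'M[F]_(\rank A, k)) (p : 'I_(\rank A) -> 'I_k),
    [/\ (B :=: A)%MS, injective p & colsub p B = 1%:M].
Proof.
have full : row_full (row_base A)^T.
  by rewrite /row_full mxrank_tr eq_row_base.
pose p := fullrankfun full.
pose P := rowsub p (row_base A)^T.
have Pu : P \in unitmx by apply: fullrowsub_unit.
exists (invmx P^T *m row_base A), p; split; last first.
- rewrite -mulmx_colsub; have -> : colsub p (row_base A) = P^T.
    by apply/matrixP => a b; rewrite !mxE.
  by rewrite mulVmx // unitmx_tr.
- exact: fullrankfun_inj.
apply: eqmx_trans (eq_row_base A); apply: eqmxMfull.
by rewrite row_full_unit unitmx_inv unitmx_tr.
Qed.

(* [normals *m points^T] is the distance matrix: the i-th row of [normals] is the
   tangent line to the parabola [y = x ^ 2] at [alpha i]. *)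
Definition parabola_points (R : pzRingType) n (alpha : 'I_n -> R) : 'M[R]_(n, 3) :=
  \matrix_(i, t) alpha i ^+ t.
Definition parabola_normals (R : pzRingType) n (alpha : 'I_n -> R) : 'M[R]_(n, 3) :=
  \matrix_(i, t) [:: alpha i ^+ 2; - (2 * alpha i); 1]`_t.

Lemma edm_parabola (R : comPzRingType) n (alpha : 'I_n -> R) :
  edm alpha = parabola_normals alpha *m (parabola_points alpha)^T.
Proof.
apply/matrixP => i j; rewrite !mxE sum_ord3 !mxE /=; ring.
Qed.

(** A vector orthogonal to all normals gives a polynomial of degree at most 2 with [n >= 3] distinct
    roots. *)
Lemma parabola_normals_full (R : realFieldType) n (alpha : 'I_n -> R) :
  (3 <= n)%N -> injective alpha -> row_full (parabola_normals alpha).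
Proof.
move=> n3 inj; rewrite /row_full -mxrank_tr -/(row_free _) -kermx_eq0.
apply/rowV0P => w /sub_kermxP w0.
have eqn i : w 0 0 * alpha i ^+ 2 - w 0 1 * (2 * alpha i) + w 0 2%:R = 0.
  by move/matrixP/(_ 0 i): w0; rewrite !mxE sum_ord3 !mxE /= => <-; ring.
pose p : {poly R} := \poly_(t < 3) [:: w 0 2%:R; - (2 * w 0 1); w 0 0]`_t.
have p0 : p = 0.
  apply/eqP; apply: contraT => pn0.
  have roots_p : all (root p) (map alpha (enum 'I_n)).
    apply/allP => _ /mapP[i _ ->]; apply/rootP.
    by apply: etrans (eqn i); rewrite horner_poly !big_ord_recl big_ord0 /= /bump /=; ring.
  have := max_poly_roots pn0 roots_p.
  rewrite map_inj_uniq ?enum_uniq // size_map size_enum_ord => /(_ isT).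
  by rewrite ltnNge (leq_trans (size_poly _ _) n3).
have pE t : p`_t = 0 by rewrite p0 coef0.
have := pE 0; have := pE 1%N; have := pE 2%N; rewrite !coef_poly /= => w00 w1 w2.
apply/rowP => t; rewrite mxE.
have : [|| t == 0, t == 1 | t == 2%:R] by case: t => -[|[|[|//]]].
case/or3P => /eqP -> //.
by apply/eqP; move/eqP: w1; rewrite oppr_eq0 mulf_eq0 pnatr_eq0.
Qed.

(** * Degree bounds and the transcendence degree inequality *)

Lemma msizeM_bound (m : nat) (R : idomainType) (p q : {mpoly R[m]}) a b :
  (msize p <= a.+1 -> msize q <= b.+1 -> msize (p * q) <= (a + b).+1)%N.
Proof.
have [->|p0] := eqVneq p 0; first by rewrite mul0r msize0.
have [->|q0] := eqVneq q 0; first by rewrite mulr0 msize0.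
by move=> pa qb; rewrite msizeM //; lia.
Qed.

Lemma msizeX_bound (m : nat) (R : idomainType) (p : {mpoly R[m]}) a e :
  (msize p <= a.+1 -> msize (p ^+ e) <= (e * a).+1)%N.
Proof.
move=> pa; elim: e => [|e IHe]; first by rewrite expr0 msize1.
by rewrite exprS mulSn msizeM_bound.
Qed.

Lemma msize_prod_bound (m : nat) (R : idomainType) n (p : 'I_n -> {mpoly R[m]}) a :
  (forall i, msize (p i) <= a.+1)%N -> (msize (\prod_i p i) <= (n * a).+1)%N.
Proof.
elim: n p => [|n IHn] p pa; first by rewrite big_ord0 msize1.
by rewrite big_ord_recl mulSn msizeM_bound // IHn.
Qed.

Lemma card_bmultinom m N : (#|{: 'X_{1..m < N}}| <= N ^ m)%N.
Proof.
have le_mdeg (e : 'X_{1..m}) i : (e i <= mdeg e)%N.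
  by rewrite mdegE (bigD1 i) //= leq_addr.
pose h (e : 'X_{1..m < N}) : {ffun 'I_m -> 'I_N} :=
  [ffun i => Ordinal (leq_ltn_trans (le_mdeg (bmnm e) i) (bmdeg e))].
have h_inj : injective h.
  move=> e e' /ffunP ee'; apply: val_inj; apply/mnmP => i.
  by have /(congr1 val) := ee' i; rewrite !ffunE.
by have := leq_card h h_inj; rewrite card_ffun !card_ord.
Qed.

(* If [m < n], the n-variable monomials with exponents [< d], after clearing denominators,
   are [d ^ n] elements of a space spanned by [O(d ^ m)] monomials in [y]. *)
Lemma transcendence_bound (R : realFieldType) n (alpha : 'I_n -> R) m (y : 'I_m -> R) :
  alg_indep_Q alpha -> (forall i, alpha i \in adjoinQ y) -> (n <= m)%N.
Proof.
move=> indep alphaK; rewrite leqNgt; apply/negP => ltmn.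
have [p pP] := choice (fun i => elimT (adjoinQP y _) (alphaK i)).
have [q qP] := choice pP.
pose C := (\max_i (msize (p i) + msize (q i)))%N.
have [pC qC] : (forall i, msize (p i) <= C.+1)%N /\ (forall i, msize (q i) <= C.+1)%N.
  by split=> i; have := leq_bigmax (F := fun i => msize (p i) + msize (q i))%N i; rewrite -/C; lia.
(* This makes [((n * C).+1 * d) ^ m < d ^ m.+1], which is at most [d ^ n]. *)
pose d := ((n * C).+1 ^ m).+1.
pose F (e : {ffun 'I_n -> 'I_d}) := \prod_i (p i ^+ e i * q i ^+ (d - e i)).
pose N := (n * (d * C)).+1.
have sizeF e : (msize (F e) <= N)%N.
  apply: msize_prod_bound => i.
  have -> : (d * C = e i * C + (d - e i) * C)%N by rewrite -mulnDl subnKC // ltnW.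
  by rewrite msizeM_bound // msizeX_bound.
have evalF e : evalQ y (F e) = (\prod_i evalQ y (q i) ^+ d) * \prod_i alpha i ^+ e i.
  rewrite rmorph_prod -big_split /=; apply: eq_bigr => i _.
  have [q0 ->] := qP i.
  have -> : evalQ y (q i) ^+ d = evalQ y (q i) ^+ (d - e i) * evalQ y (q i) ^+ e i.
    by rewrite -exprD subnK // ltnW.
  rewrite rmorphM !rmorphXn expr_div_n -mulrA [evalQ y (q i) ^+ e i * _]mulrC.
  by rewrite divfK ?expf_neq0 // mulrC.
have cardlt : (#|{: 'X_{1..m < N}}| < #|{ffun 'I_n -> 'I_d}|)%N.
  apply: leq_ltn_trans (card_bmultinom m N) _.
  rewrite card_ffun !card_ord.
  have Nle : (N <= (n * C).+1 * d)%N by rewrite /N /d; nia.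
  apply: (@leq_ltn_trans (((n * C).+1 * d) ^ m)); first by case: (m) => // m1; rewrite leq_exp2r.
  rewrite expnMn; apply: (@leq_trans (d ^ m.+1)); last by rewrite leq_pexp2l.
  by rewrite expnS ltn_mul2r expn_gt0 /= ltnSn.
have [c [e ce] csum] := @dependent_of_card R _ _ (fun e => evalQ y (F e))
  (fun M => mmap1 y (bmnm M)) (fun e M => (F e)@_(bmnm M)) cardlt
  (fun e => mmapE _ (sizeF e)).
move: ce; rewrite (indep d c) ?eqxx //.
have q0 : \prod_i evalQ y (q i) ^+ d != 0.
  by apply/prodf_neq0 => i _; rewrite expf_neq0 //; case: (qP i).
apply: (mulfI q0); rewrite mulr0; apply: etrans csum; rewrite mulr_sumr; apply: eq_bigr => f _.
by rewrite evalF mulrCA.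
Qed.

(** * Counting the parameters of a factorization *)

Lemma rank1_factor (F : fieldType) n k (A : 'M[F]_(n, k)) :
  \rank A = 1%N -> exists u (v : 'rV_k), A = u *m v.
Proof.
move=> rk; move: (col_base A) (row_base A) (mulmx_base A).
by rewrite rk => c r <-; exists c, r.
Qed.

Lemma map_mx_val_adjoinQ (R : realFieldType) l (y : 'I_l -> R) n k (M : 'M[R]_(n, k)) :
  (forall i j, M i j \in adjoinQ y) -> exists N : 'M[Qadj y]_(n, k), M = map_mx val N.
Proof.
move=> MK; exists (\matrix_(i, j) Sub (M i j) (MK i j)).
by apply/matrixP => i j; rewrite !mxE SubK.
Qed.

(* In echelon form the row space of [V] costs [r * (k - r)] parameters, and the last two
   coordinates of the map to R^3 on its basis cost [2 * r] more. *)
Lemma edm_factor_bound (R : realFieldType) n k (alpha : 'I_n -> R) (U V : 'M[R]_(n, k)) :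
  (3 <= n)%N -> alg_indep_Q alpha -> edm alpha = U *m V^T ->
  (forall i s, U i s * V i s = 0) -> (n <= \rank V * (k + 2 - \rank V))%N.
Proof.
move=> n3 indep UV disj.
have /row_fullP[H' H'K] := parabola_normals_full n3 (alg_indep_inj indep).
rewrite edm_parabola in UV; set H := parabola_normals _ in UV H'K.
set T := parabola_points _ in UV.
(* As [H'] is a left inverse of [H], cancelling [H] in [UV] shows that [E] sends the rows of [V] to
   the parabola points. *)
pose E := (H' *m U)^T.
have VE : V *m E = T.
  apply: trmx_inj; rewrite trmx_mul trmxK -mulmxA -UV mulmxA H'K mul1mx //.
have [B [p [eqBV p_inj Bp]]] := pivot_basis V.
have BpE q q' : B q (p q') = (q == q')%:R.
  by move/matrixP/(_ q q'): Bp; rewrite !mxE.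
have ler : (\rank V <= k)%N := rank_leq_col V.
move: (\rank V) B p eqBV p_inj Bp BpE ler => r B p eqBV p_inj Bp BpE ler.
(* Rescaling the rows of [B] puts the first column of [B *m E] in {0, 1}; rescaling
   the columns, which preserves all zero patterns, then restores the pivots to 1. *)
pose d := \row_q (if (B *m E) q 0 == 0 then 1 else ((B *m E) q 0)^-1).
have d0 q : d 0 q != 0 by rewrite mxE; case: ifPn; rewrite ?oner_eq0 ?invr_eq0.
pose B1 := diag_mx d *m B.
have B1E q s : B1 q s = d 0 q * B q s by rewrite /B1 mul_diag_mx mxE.
have eqB1V : (B1 :=: V)%MS.
  apply: eqmx_trans eqBV; apply: eqmxMfull; rewrite row_full_unit unitmxE det_diag.
  by rewrite unitfE; apply/prodf_neq0.
pose L := B1 *m E.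
have L0 q : L q 0 = 0 \/ L q 0 = 1.
  have -> : L = diag_mx d *m (B *m E) by rewrite mulmxA.
  rewrite mul_diag_mx mxE [d _ _]mxE; case: eqP => [->|/eqP nz].
    by left; rewrite mulr0.
  by right; rewrite mulVf.
pose g s := if [pick q | p q == s] is Some q then (d 0 q)^-1 else 1.
have g0 s : g s != 0.
  by rewrite /g; case: pickP => *; rewrite ?oner_eq0 ?invr_eq0.
pose B2 := \matrix_(q, s) (B1 q s * g s).
have B2_eq0 (x : 'rV_r) s : ((x *m B2) 0 s == 0) = ((x *m B1) 0 s == 0).
  have -> : (x *m B2) 0 s = (x *m B1) 0 s * g s.
    rewrite [LHS]mxE [in RHS]mxE mulr_suml; apply: eq_bigr => q _.
    by rewrite [B2 _ _]mxE mulrA.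
  by rewrite mulf_eq0 (negPf (g0 s)) orbF.
pose y := [seq B1 q s | q <- enum 'I_r, s <- enum [predC codom p]] ++
  [seq L q 1 | q <- enum 'I_r] ++ [seq L q 2%:R | q <- enum 'I_r].
have size_y : size y = (r * (k + 2 - r))%N.
  have := cardC (mem (codom p)); rewrite card_codom // !card_ord => cC.
  rewrite !size_cat size_allpairs size_enum_ord !(size_map (L ^~ _)) size_enum_ord -cardE.
  rewrite (_ : #|_| = k - r)%N; last by rewrite -[in RHS]cC addKn.
  by rewrite [in RHS]addnC -addnBA // mulnDr muln2 addnn addnC.
pose Y (i : 'I_(size y)) := y`_i.
have yK x : x \in y -> x \in adjoinQ Y.
  move=> /(nthP 0)[i lti <-]; exact: (gen_adjoinQ Y (Ordinal lti)).
(* Pivot columns of [B2] have entries 0 and 1; on the other columns [g] is 1, so the entries are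
   listed in [y]. *)
have [A AE] : exists A, B2 = map_mx (val : Qadj Y -> R) A.
  apply: map_mx_val_adjoinQ => q s; rewrite mxE /g; case: pickP => [q' /eqP <-|np].
    rewrite B1E BpE; case: eqP => [->|_]; last by rewrite mulr0 mul0r rpred0.
    by rewrite mulr1 divff // rpred1.
  rewrite mulr1 yK // mem_cat; apply/orP; left; apply/allpairsP; exists (q, s).
  rewrite !mem_enum; split => //=; apply/codomP => -[q' sE].
  by have := np q'; rewrite sE eqxx.
have [M ME] : exists M, L = map_mx (val : Qadj Y -> R) M.
  apply: map_mx_val_adjoinQ => q t.
  have memL (c : 'I_3) : L q c \in [seq L q c | q <- enum 'I_r].
    by apply/mapP; exists q; rewrite ?mem_enum.
  have : [|| t == 0, t == 1 | t == 2%:R] by case: t => -[|[|[|//]]].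
  case/or3P => /eqP ->.
  - by case: (L0 q) => ->; rewrite ?rpred0 ?rpred1.
  - by rewrite yK // !mem_cat memL orbT.
  - by rewrite yK // !mem_cat memL !orbT.
rewrite -size_y; apply: (transcendence_bound (y := Y) indep) => i.
suff [a ->] : exists a, alpha i = (val : Qadj Y -> R) a by apply: valP.
apply: (parabola_descent (A := A) (L := M) (S := fun s => U i s != 0)); rewrite -AE -ME.
  (* A vector of the row space of [V] vanishing on the support of row [i] of [U] is killed by that
     row, which acts through [E] as the tangent line. *)
  move=> x xS.
  have /submxP[c cV] : (x *m B1 <= V)%MS by rewrite -eqB1V submxMl.
  have : (U *m (x *m B1)^T) i 0 = 0.
    rewrite mxE big1 // => s _; rewrite [_^T _ _]mxE.
    have [->|Us] := eqVneq (U i s) 0; first by rewrite mul0r.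
    by have /eqP := xS s Us; rewrite B2_eq0 => /eqP ->; rewrite mulr0.
  rewrite cV trmx_mul mulmxA -UV -mulmxA -trmx_mul -VE mulmxA -cV -mulmxA -/L.
  rewrite mxE sum_ord3 ![H _ _]mxE ![_^T _ _]mxE /= => <-; ring.
(* The witness is row [i] of [V], written in the basis [B1]. *)
have /submxP[x xE] : (row i V <= B1)%MS by rewrite eqB1V row_sub.
have xL t : (x *m L) 0 t = alpha i ^+ t.
  by rewrite mulmxA -xE -row_mul VE !mxE.
exists x; split; last by rewrite !xL.
move=> s Us; apply/eqP; rewrite B2_eq0 -xE mxE.
by have /eqP := disj i s; rewrite mulf_eq0 (negPf Us).
Qed.

(* rank_+ D(alpha) >= 2 sqrt n - 2: every decomposition of D(alpha) as a sum
   of k nonnegative rank-one matrices has k >= 2 sqrt n - 2. *)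
Theorem theorem1 (R : rcfType) (n : nat) (alpha : 'I_n -> R) :
  (3 <= n)%N -> alg_indep_Q alpha ->
  forall k : nat, nonneg_rank1_sum k (edm alpha) ->
    2 * Num.sqrt (n%:R) - 2 <= (k%:R : R).
Proof.
move=> n3 indep k [B [B_nn_rk1 edmB]].
have /choice[u /choice[v Buv]] : forall l, exists u (v : 'rV_n), B l = u *m v.
  by move=> l; apply: rank1_factor; case: (B_nn_rk1 l).
pose U := \matrix_(i, l) u l i 0; pose V := \matrix_(j, l) v l 0 j.
have BE l i j : B l i j = U i l * V j l by rewrite Buv !mxE big_ord1.
have edmE i j : edm alpha i j = \sum_l B l i j by rewrite edmB summxE.
have disj i l : U i l * V i l = 0.
  (* Nonnegative summands of a zero diagonal entry all vanish. *)
  have /psumr_eq0P trace0 : \sum_l B l i i = 0 by rewrite -edmE mxE subrr expr0n.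
  by rewrite -BE trace0 // => l' _; case: (B_nn_rk1 l').
have UV : edm alpha = U *m V^T.
  apply/matrixP => i j; rewrite edmE [RHS]mxE; apply: eq_bigr => l _.
  by rewrite BE [V^T _ _]mxE.
have nle := edm_factor_bound n3 indep UV disj.
have le_sqr : (4 * n <= (k + 2) ^ 2)%N.
  have := nat_AGM2 (\rank V) (k + 2 - \rank V).
  rewrite subnKC; last by rewrite (leq_trans (rank_leq_col V)) // leq_addr.
  by case=> /(leq_trans _) -> //; rewrite leq_mul2l.
rewrite lerBlDr -(ler_sqr (x := 2 * _)) ?nnegrE ?mulr_ge0 ?sqrtr_ge0 ?addr_ge0 //.
by rewrite exprMn sqr_sqrtr // -natrD -!natrX -natrM ler_nat.
Qed.
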